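(* Every Markov free topological group (over an arbitrary topological space $X$) is a projective topological group, and every Graev free topological group (over an arbitrary pointed topological space $(X,e)$) is a projective topological group.
   Context: Topological groups and spaces are not assumed Hausdorff. A topological group $P$ is projective if for every continuous epimorphism (surjective homomorphism) of topological groups $\pi:A\to B$ having a continuous section (a continuous map $s:B\to A$, not necessarily a homomorphism, with $\pi s=\mathrm{Id}_B$), and every continuous homomorphism $f:P\to B$, there is a continuous homomorphism $g:P\to A$ with $\pi g=f$. The Markov free topological group over a topological space $X$ is a pair $(F_X,\sigma_X)$, where $F_X$ is the free group on the set $X$ with canonical map $\sigma_X:X\to F_X$, equipped with the finest group topology making $\sigma_X$ continuous; every continuous map from $X$ to a topological group $H$ factors through $\sigma_X$ by a unique continuous homomorphism $F_X\to H$. The Graev free topological group over a pointed space $(X,e)$ is the analogous pair $(F^*_X,\sigma^*_X)$, where $F^*_X$ is the free group on the pointed set $(X,e)$ (so $\sigma^*_X(e)=1$) with the finest group topology making $\sigma^*_X$ continuous; every continuous map $X\to H$ to a topological group sending $e$ to $1$ factors through $\sigma_X^*$ by a unique continuous homomorphism $F^*_X\to H$. *)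

(* Defs.v *)
From HB Require Import structures.
From mathcomp Require Import all_boot monoid.
From mathcomp Require Import generic_quotient.
From mathcomp Require Import boolp classical_sets functions filter topology.

Set Implicit Arguments.
Unset Strict Implicit.
Unset Printing Implicit Defensive.

Local Open Scope classical_set_scope.
Local Open Scope quotient_scope.
Local Open Scope group_scope.

HB.mixin Record isTopologicalGroup G of Group G & Topological G := {
  mulg_continuous : continuous (fun p : G * G => p.1 * p.2 : G);
  invg_continuous : continuous (fun x : G => x^-1)
}.

#[short(type="topologicalGroupType")]
HB.structure Definition TopologicalGroup :=
  {G of isTopologicalGroup G & Group G & Topological G}.

(* A multiplicative map between groups preserves 1, so that
   {multiplicative A -> B} is the type of group homomorphisms. *)
Definition projective (P : topologicalGroupType) : Prop :=
  forall (A B : topologicalGroupType) (pi : {multiplicative A -> B}),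
    continuous pi ->
    (forall b : B, exists a : A, pi a = b) ->
    (exists2 s : B -> A, continuous s & cancel s pi) ->
  forall f : {multiplicative P -> B}, continuous f ->
  exists2 g : {multiplicative P -> A}, continuous g & pi \o g =1 f.

(* The group generated by X subject only to the relations x = 1 for x in K, as
   words modulo the congruence generated by free cancellation and deletion of
   the letters of K. The letter (x, true) stands for x, (x, false) for x^-1.
   For K = set0 this is the free group on the set X, and for K = [set e] the
   free group on the pointed set (X, e). *)
Section FreeGroup.
Variables (X : choiceType) (K : set X).
Local Notation word := (seq (X * bool)).
Implicit Types (u v w : word) (x : X) (b : bool).

Inductive word_equiv : word -> word -> Prop :=
| word_equiv_refl u : word_equiv u u
| word_equiv_sym u v : word_equiv u v -> word_equiv v u
| word_equiv_trans v u w : word_equiv u v -> word_equiv v w -> word_equiv u w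
| word_equiv_cancel u v x b :
    word_equiv (u ++ (x, b) :: (x, ~~ b) :: v) (u ++ v)
| word_equiv_kill u v x b : K x -> word_equiv (u ++ (x, b) :: v) (u ++ v).

Definition word_eqb : rel word := fun u v => `[< word_equiv u v >].

Fact word_eqb_equiv : equiv_class_of word_eqb.
Proof.
split.
- by move=> u; apply/asboolP; exact: word_equiv_refl.
- by move=> u v; apply/asboolP/asboolP; exact: word_equiv_sym.
- move=> v u w /asboolP uv /asboolP vw; apply/asboolP.
  exact: word_equiv_trans uv vw.
Qed.

Canonical word_eqb_equiv_rel := EquivRelPack word_eqb_equiv.

Definition free_group : Type := {eq_quot word_eqb}.
HB.instance Definition _ := Choice.on free_group.
HB.instance Definition _ := Quotient.on free_group.

Definition word_class u : free_group := \pi_free_group u.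

Definition free_gen x : free_group := word_class [:: (x, true)].

Lemma eq_free_group u v :
  word_class u = word_class v <-> word_equiv u v.
Proof.
split=> [/eqmodP/asboolP//|uv].
by apply/eqmodP; apply/asboolP.
Qed.

Lemma word_class_repr (a : free_group) : word_class (repr a) = a.
Proof. exact: reprK. Qed.

Lemma word_equiv_cat u u' v v' :
  word_equiv u u' -> word_equiv v v' -> word_equiv (u ++ v) (u' ++ v').
Proof.
move=> uu' vv'; apply: (@word_equiv_trans (u' ++ v)).
- elim: uu' => {u u'}.
  + by move=> u; exact: word_equiv_refl.
  + by move=> u u' _; exact: word_equiv_sym.
  + by move=> u' u u'' _ IH1 _; exact: word_equiv_trans.
  + by move=> u w x b; rewrite -!catA; exact: word_equiv_cancel.
  + by move=> u w x b Kx; rewrite -!catA; exact: word_equiv_kill.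
- elim: vv' => {v v'}.
  + by move=> v; exact: word_equiv_refl.
  + by move=> v v' _; exact: word_equiv_sym.
  + by move=> v' v v'' _ IH1 _; exact: word_equiv_trans.
  + by move=> v w x b; rewrite !catA; exact: word_equiv_cancel.
  + by move=> v w x b Kx; rewrite !catA; exact: word_equiv_kill.
Qed.

Definition word_inv u : word := rev [seq (l.1, ~~ l.2) | l <- u].

Lemma word_inv_cat u v : word_inv (u ++ v) = word_inv v ++ word_inv u.
Proof. by rewrite /word_inv map_cat rev_cat. Qed.

Lemma word_inv_cons x b u : word_inv ((x, b) :: u) = word_inv u ++ [:: (x, ~~ b)].
Proof. by rewrite -cat1s word_inv_cat. Qed.

Lemma word_invK : involutive word_inv.
Proof.
by elim=> [//|[x b] u IH]; rewrite word_inv_cons word_inv_cat IH /= negbK.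
Qed.

Lemma word_equiv_inv u v :
  word_equiv u v -> word_equiv (word_inv u) (word_inv v).
Proof.
elim=> {u v}.
- by move=> u; exact: word_equiv_refl.
- by move=> u v _; exact: word_equiv_sym.
- by move=> v u w _ IH1 _; exact: word_equiv_trans.
- move=> u v x b; rewrite !word_inv_cat !word_inv_cons negbK -!catA /=.
  exact: word_equiv_cancel.
- move=> u v x b Kx; rewrite !word_inv_cat word_inv_cons -!catA /=.
  exact: word_equiv_kill.
Qed.

Lemma word_equivN u : word_equiv (u ++ word_inv u) [::].
Proof.
elim: u => [|[x b] u IH]; first exact: word_equiv_refl.
rewrite word_inv_cons catA -cat1s -!catA (catA u).
apply: (@word_equiv_trans ([:: (x, b)] ++ [::] ++ [:: (x, ~~ b)])).
  apply: word_equiv_cat; first exact: word_equiv_refl.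
  by apply: word_equiv_cat => //; exact: word_equiv_refl.
exact: (word_equiv_cancel [::] [::]).
Qed.

Definition free_one : free_group := word_class [::].
Definition free_mul (a b : free_group) : free_group :=
  word_class (repr a ++ repr b).
Definition free_inv (a : free_group) : free_group :=
  word_class (word_inv (repr a)).

Lemma repr_word_class u : word_equiv (repr (word_class u)) u.
Proof. by apply/eq_free_group; rewrite word_class_repr. Qed.

Lemma free_mulE u v :
  free_mul (word_class u) (word_class v) = word_class (u ++ v).
Proof. by apply/eq_free_group; apply: word_equiv_cat; exact: repr_word_class. Qed.

Lemma free_invE u : free_inv (word_class u) = word_class (word_inv u).
Proof. by apply/eq_free_group; apply: word_equiv_inv; exact: repr_word_class. Qed.

Fact free_mulA : associative free_mul.
Proof.
move=> a b c; rewrite -[a]word_class_repr -[b]word_class_repr -[c]word_class_repr.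
by rewrite !free_mulE catA.
Qed.

Fact free_mul1g : left_id free_one free_mul.
Proof. by move=> a; rewrite -[a]word_class_repr free_mulE. Qed.

Fact free_mulg1 : right_id free_one free_mul.
Proof. by move=> a; rewrite -[a]word_class_repr free_mulE cats0. Qed.

Fact free_mulgV : right_inverse free_one free_inv free_mul.
Proof.
move=> a; rewrite -[a]word_class_repr free_invE free_mulE; apply/eq_free_group.
exact: word_equivN.
Qed.

Fact free_mulVg : left_inverse free_one free_inv free_mul.
Proof.
move=> a; rewrite -[a]word_class_repr free_invE free_mulE; apply/eq_free_group.
by rewrite -[X in _ ++ X]word_invK; exact: word_equivN.
Qed.

HB.instance Definition _ := isGroup.Build free_group
  free_mulA free_mul1g free_mulg1 free_mulVg free_mulgV.

End FreeGroup.

Definition group_topology (G : groupType) (Tc : Topological G) : Prop :=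
  let T := Topological.Pack Tc in
  continuous (fun p : T * T => ((p.1 : G) * (p.2 : G) : T)) /\
  continuous (fun x : T => ((x : G)^-1 : T)).

Section FreeTopologicalGroup.
Variables (X : topologicalType) (K : set X).
Local Notation F := (free_group K).

Definition admissible (Tc : Topological F) : Prop :=
  group_topology Tc /\ continuous (@free_gen X K : X -> Topological.Pack Tc).

(* The supremum of all admissible topologies; it is itself admissible (see
   free_topology_admissible), hence the finest one. *)
Definition free_topology (Tc : {Tc : Topological F | admissible Tc}) :
  Topological F := sval Tc.

Definition free_topological_group : Type := sup_topology free_topology.

HB.instance Definition _ := Topological.on free_topological_group.
HB.instance Definition _ := Group.copy free_topological_group F.
Local Notation FT := free_topological_group.

Lemma continuous_to_free (Y : topologicalType) (f : Y -> FT) :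
  (forall Tc : {Tc | admissible Tc},
     continuous (f : Y -> Topological.Pack (free_topology Tc))) ->
  continuous f.
Proof. by move=> cf y; apply/cvg_sup => Tc; exact: cf. Qed.

(* FT is finer than every admissible topology. *)
Lemma free_topology_finest (Tc : Topological F) :
  admissible Tc -> continuous (id : FT -> Topological.Pack Tc).
Proof.
move=> aTc t; have [/(_ cvg_id) cvgt _] :=
  @cvg_sup F _ free_topology (nbhs (t : FT)) t (nbhs_filter (t : FT)).
exact: (cvgt (exist _ Tc aTc)).
Qed.

Lemma continuous_free_gen : continuous (@free_gen X K : X -> FT).
Proof. by apply: continuous_to_free => Tc; case: (svalP Tc). Qed.

Fact free_mulg_continuous : continuous (fun p : FT * FT => p.1 * p.2 : FT).
Proof.
apply: continuous_to_free => Tc p.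
have aTc := svalP Tc; have cid := free_topology_finest aTc.
pose T := Topological.Pack (sval Tc); have [[cM _] _] := aTc.
have cpair : {for p, continuous (fun q : FT * FT => (q.1, q.2) : T * T)}.
  apply: (@cvg_pair _ _ _ _ (nbhs (p.1 : T)) (nbhs (p.2 : T))) => /=.
    exact: (cvg_trans (cvg_app _ cvg_fst) (cid p.1)).
  exact: (cvg_trans (cvg_app _ cvg_snd) (cid p.2)).
exact: (continuous_comp cpair (cM (p.1, p.2))).
Qed.

Fact free_invg_continuous : continuous (fun x : FT => x^-1).
Proof.
apply: continuous_to_free => Tc x.
have aTc := svalP Tc; have cid := free_topology_finest aTc.
pose T := Topological.Pack (sval Tc); have [[_ cV] _] := aTc.
apply: (@continuous_comp FT T T id (fun y : T => (y : F)^-1)); first exact: cid.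
exact: cV.
Qed.

HB.instance Definition _ := isTopologicalGroup.Build FT
  free_mulg_continuous free_invg_continuous.

Lemma free_topology_admissible : admissible (Topological.class FT).
Proof.
split; last exact: continuous_free_gen.
by split; [exact: free_mulg_continuous|exact: free_invg_continuous].
Qed.

End FreeTopologicalGroup.

Definition markov_free (X : topologicalType) : topologicalGroupType :=
  free_topological_group (set0 : set X).

Definition graev_free (X : topologicalType) (e : X) : topologicalGroupType :=
  free_topological_group [set e].

(* Main.v *)
From HB Require Import structures.
Require Import Defs.
From mathcomp Require Import all_boot monoid.
From mathcomp Require Import boolp classical_sets functions filter topology.

(** Let [F] be the free topological group on a space [X] with the points of
    [K] sent to 1: the Markov group is the case [K = set0], the Graev group the
    case [K = [set e]].  Projectivity is the usual argument for free objects: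
    lift the images of the generators and extend freely.

    Given [pi : A -> B] with continuous section [s], and [f : F -> B], the map
    [s \o f \o free_gen : X -> A] is continuous and lifts the generators, but it
    need not send [K] to 1, because [s 1] is only some element of the kernel of
    [pi].  Translating the section to [b |-> (s 1)^-1 * s b] keeps it a
    continuous section and makes it send 1 to 1 ([normalized_section]), so both
    kinds of free group can be treated at once.

    The lifted map extends to a homomorphism [g : F -> A] by multiplying out
    words.  Its continuity is the universal property of the topology of [F]
    ([continuous_free_lift]): the initial topology of [g] is a group topology
    for which the generator map is continuous, hence it is coarser than the
    topology of [F].  Finally [pi \o g] and [f] agree on the generators, hence
    everywhere ([free_hom_ext]). *)

Set Implicit Arguments.
Unset Strict Implicit.
Unset Printing Implicit Defensive.

Local Open Scope classical_set_scope.
Local Open Scope group_scope.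

Section MultiplicativeGroups.
Variables (G H : groupType) (f : {multiplicative G -> H}).

(** In a group the only idempotent is 1. *)
Lemma multiplicative1 : f 1 = 1.
Proof. by apply: (mulgI (f 1)); rewrite -gmulfM !mulg1. Qed.

Lemma multiplicativeV : {morph f : x / x^-1}.
Proof.
by move=> x; apply: (mulgI (f x)); rewrite -gmulfM !mulgV multiplicative1.
Qed.

End MultiplicativeGroups.

Section FreeLift.
Variables (X : choiceType) (K : set X) (G : groupType) (h : X -> G).
Hypothesis hK : forall x, K x -> h x = 1.

Definition letter_val (l : X * bool) : G := if l.2 then h l.1 else (h l.1)^-1.

Definition word_val (w : seq (X * bool)) : G := \prod_(l <- w) letter_val l.

(** Adjacent opposite letters have inverse values, and by [hK] the letters of
    [K] have value 1; hence evaluation of words passes to the quotient. *)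
Lemma word_val_equiv u v : word_equiv K u v -> word_val u = word_val v.
Proof.
rewrite /word_val; elim=> {u v} //.
- by move=> u v w _ -> _ ->.
- move=> u v x b; rewrite !big_cat !big_cons /= (mulgA (letter_val _)).
  rewrite /letter_val /=.
  by case: b => /=; rewrite ?mulgV ?mulVg mul1g.
- move=> u v x b Kx; rewrite !big_cat big_cons /letter_val /= (hK Kx).
  by rewrite invg1 if_same mul1g.
Qed.

Definition free_lift (a : free_group K) : G := word_val (repr a).

Lemma free_lift_class u : free_lift (word_class K u) = word_val u.
Proof. exact: word_val_equiv (repr_word_class K u). Qed.

Lemma free_lift_gen x : free_lift (free_gen K x) = h x.
Proof. by rewrite free_lift_class /word_val big_seq1. Qed.

Lemma free_liftM : {morph free_lift : a b / a * b}.
Proof.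
move=> a b; rewrite -[a]word_class_repr -[b]word_class_repr.
by rewrite [_ * _]free_mulE !free_lift_class /word_val big_cat.
Qed.

End FreeLift.

Lemma free_hom_ext (X : choiceType) (K : set X) (G : groupType)
    (f g : {multiplicative free_group K -> G}) :
  (forall x, f (free_gen K x) = g (free_gen K x)) -> f =1 g.
Proof.
move=> fg a; rewrite -[a]word_class_repr.
elim: (repr a) => [|[x b] w IH].
  by rewrite -[word_class K [::]]/(1 : free_group K) !multiplicative1.
have -> : word_class K ((x, b) :: w) = word_class K [:: (x, b)] * word_class K w.
  by rewrite [RHS]free_mulE.
rewrite !gmulfM IH; congr (_ * _).
case: b; first exact: fg.
have -> : word_class K [:: (x, false)] = (free_gen K x)^-1.
  by rewrite [RHS]free_invE.
by rewrite !multiplicativeV fg.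
Qed.

Section PullbackTopology.
Variables (F : groupType) (G : topologicalGroupType).
Variable g : {multiplicative F -> G}.
Local Notation W := (initial_topology g).

(** A map into [W] is continuous as soon as its composite with [g] is, and [g]
    turns the operations of [F] into those of [G], which are continuous. *)
Lemma group_topology_initial : group_topology (Topological.class W).
Proof.
have cg : continuous (g : W -> G) := @initial_continuous _ _ g.
split; apply: continuous_comp_initial.
- have -> : g \o (fun p : W * W => (p.1 : F) * p.2 : W) =
      (fun q : G * G => q.1 * q.2) \o (fun p : W * W => (g p.1, g p.2)).
    by apply/funext => p /=; rewrite gmulfM.
  move=> p; apply: continuous_comp; last exact: mulg_continuous.
  apply: (@cvg_pair _ _ _ _ (nbhs (g p.1)) (nbhs (g p.2))) => /=.
    exact: (cvg_trans (cvg_app _ cvg_fst) (cg p.1)).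
  exact: (cvg_trans (cvg_app _ cvg_snd) (cg p.2)).
- have -> : g \o (fun x : W => (x : F)^-1 : W) =
      (fun y : G => y^-1) \o (g : W -> G).
    by apply/funext => x /=; rewrite multiplicativeV.
  move=> x; apply: continuous_comp; first exact: cg.
  exact: invg_continuous.
Qed.

End PullbackTopology.

(** Since [g] is continuous for its own initial topology, it is enough that this
    topology is one of those of which the topology of the free group is the
    supremum; the hypothesis on generators is what this requires. *)
Lemma continuous_free_lift (X : topologicalType) (K : set X)
    (G : topologicalGroupType)
    (g : {multiplicative free_topological_group K -> G}) :
  continuous (fun x : X => g (free_gen K x)) -> continuous g.
Proof.
move=> cgen; pose W := initial_topology (g : free_group K -> G).
have adm : admissible (Topological.class W).
  split; first exact: (group_topology_initial g).
  exact: continuous_comp_initial.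
move=> a; apply: (@continuous_comp (free_topological_group K) W G id g).
  exact: (free_topology_finest adm).
exact: initial_continuous.
Qed.

(** Left translation of [s] by [(s 1)^-1] is again a section since [s 1] lies in
    the kernel of [pi]. *)
Lemma normalized_section (A B : topologicalGroupType)
    (pi : {multiplicative A -> B}) :
  (exists2 s : B -> A, continuous s & cancel s pi) ->
  exists s : B -> A, [/\ continuous s, cancel s pi & s 1 = 1].
Proof.
case=> s cs sK; exists (fun b => (s 1)^-1 * s b); split.
- move=> b; apply: (@continuous_comp _ (A * A)%type A
    (fun b => ((s 1)^-1, s b)) (fun p => p.1 * p.2)).
    by apply: cvg_pair; [exact: cvg_cst|exact: cs].
  exact: mulg_continuous.
- by move=> b; rewrite gmulfM multiplicativeV !sK invg1 mul1g.
- by rewrite mulVg.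
Qed.

Lemma free_topological_group_projective (X : topologicalType) (K : set X) :
  projective (free_topological_group K).
Proof.
move=> A B pi _ _ /normalized_section[s [cs sK s1]] f cf.
pose h (x : X) : A := s (f (free_gen K x)).
have hK x : K x -> h x = 1.
  move=> Kx; rewrite /h; suff -> : free_gen K x = 1 by rewrite multiplicative1.
  by apply/eq_free_group; exact: (word_equiv_kill [::] [::]).
pose gM := isMultiplicative.Build (free_topological_group K) A
  (free_lift h) (free_liftM hK).
pose g : {multiplicative free_topological_group K -> A} :=
  HB.pack (free_lift h : free_topological_group K -> A) gM.
have g_gen x : g (free_gen K x) = h x by exact: free_lift_gen.
exists g.
  apply: continuous_free_lift; rewrite (funext g_gen) => x.
  apply: (@continuous_comp _ B A (fun x => f (free_gen K x)) s).
    apply: (@continuous_comp X (free_topological_group K) B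
      (free_gen K) f); last exact: cf.
    exact: continuous_free_gen.
  exact: cs.
apply: (@free_hom_ext _ _ _ (pi \o g : {multiplicative _ -> _}) f) => x.
exact: etrans (congr1 pi (g_gen x)) (sK _).
Qed.

Theorem lemma2p2 :
  (forall X : topologicalType, projective (markov_free X)) /\
  (forall (X : topologicalType) (e : X), projective (graev_free e)).
Proof. by split=> *; exact: free_topological_group_projective. Qed.
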